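(* Let $n$ be a positive integer and let $G=\langle a,b : a^2=b^n,\ o(a)=4,\ o(b)=2n,\ a^{-1}ba=b^{-1}\rangle$. Then $G$ is a PNC-group if and only if $4\nmid n$.
   Context: $o(g)$ denotes the order of the element $g$ (so $G$ is the group of order $4n$ generated by $a,b$ with these orders and relations). For a subgroup $H$ of $G$, $H^G$ denotes the normal closure of $H$ in $G$. $H$ is an NC-subgroup of $G$ if $H^GN_G(H)=G$; $G$ is a PNC-group if every subgroup of $G$ is an NC-subgroup of $G$. *)

(* Defs.v *)
From mathcomp Require Import all_boot all_fingroup.

Set Implicit Arguments.
Unset Strict Implicit.
Unset Printing Implicit Defensive.

Local Open Scope group_scope.

Section PNC.

Variable gT : finGroupType.
Implicit Types G H : {set gT}.

(* H^G, the subgroup generated by all the G-conjugates of elements of H. *)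
Definition normal_closure H G : {set gT} := <<class_support H G>>.

(* The product is the pointwise product of sets. *)
Definition NC_subgroup H G : Prop :=
  H \subset G /\ normal_closure H G * 'N_G(H) = G.

Definition PNC_group G : Prop :=
  forall H : {group gT}, H \subset G -> NC_subgroup H G.

End PNC.

(* Main.v *)
Require Import Defs.
From mathcomp Require Import all_boot all_fingroup.
From mathcomp Require Import cyclic.

Set Implicit Arguments.
Unset Strict Implicit.
Unset Printing Implicit Defensive.

Local Open Scope group_scope.

(** Every x in G outside <b> inverts b and satisfies x^2 = b^n, hence
    x^(b^k) = x b^(2k).  Subgroups of <b> are normal.  If H contains some x
    outside <b>, then its normal closure contains b^2 and x^2 = b^n, which
    gives b when n is odd; when n = 2m, moreover x^(b^m) = x b^n = x^3, so b^m
    normalizes H, and b^2, b^m generate b when m is odd.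
    If 4 divides n, both the normal closure and the normalizer of <a> lie in
    the proper subgroup <a><b^2>. *)

Lemma conjg_inverting_exp (gT : finGroupType) (x b : gT) k :
  b ^ x = b^-1 -> x ^ (b ^+ k) = x * b ^+ (2 * k).
Proof.
move=> bx; have bkx : (b ^+ k) ^ x = (b ^+ k)^-1 by rewrite conjXg bx expgVn.
rewrite mul2n -addnn expgD conjgE mulgA.
by rewrite [_^-1 * x]conjgC conjVg bkx invgK mulgA.
Qed.

Lemma conjg_inverting_coset (gT : finGroupType) (a b : gT) j :
  b ^ a = b^-1 -> b ^ (a * b ^+ j) = b^-1.
Proof.
move=> ba; rewrite conjgM ba conjVg; congr _^-1.
by apply/conjg_fixP/commgP/commuteX.
Qed.

Lemma sqr_inverting_coset (gT : finGroupType) (a b : gT) j :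
  b ^ a = b^-1 -> (a * b ^+ j) ^+ 2 = a ^+ 2.
Proof.
move=> ba; rewrite !expgS expg0 !mulg1 -!mulgA; congr (_ * _).
by rewrite mulgA [_ * a]conjgC conjXg ba expgVn -mulgA mulVg mulg1.
Qed.

Lemma cycle_norm_inverted (gT : finGroupType) (a b : gT) m :
  b ^ a = b^-1 -> <[a]> \subset 'N(<[b ^+ m]>).
Proof.
move=> ba; rewrite cycle_subG; apply/normP.
by rewrite -cycleJ conjXg ba expgVn cycleV.
Qed.

(** Needed for two exponents: [m = 1] gives the normal form of elements of [G], and [m = 2]
    describes the subgroup that traps [<[a]>] when [4 %| n]. *)
Lemma gen_inverted_split (gT : finGroupType) (a b : gT) m :
  b ^ a = b^-1 -> <<[set a; b ^+ m]>> = <[a]> * <[b ^+ m]>.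
Proof.
move=> ba; have -> : <<[set a; b ^+ m]>> = <[a]> <*> <[b ^+ m]>.
  by rewrite joing_idl joing_idr.
by rewrite norm_joinEl ?cycle_norm_inverted.
Qed.

Lemma dicyclic_mem (gT : finGroupType) (a b x : gT) n :
    a ^+ 2 = b ^+ n -> b ^ a = b^-1 -> x \in <<[set a; b]>> ->
  exists j, x = b ^+ j \/ x = a * b ^+ j.
Proof.
move=> a2 ba; rewrite -[b in [set a; b]]expg1 gen_inverted_split // expg1.
(* Each pair of factors [a] turns into [b ^+ n], so [a ^+ i] contributes [n * i./2] to the exponent
   of [b] and leaves [a ^+ odd i]. *)
case/mulsgP=> _ _ /cycleP[i ->] /cycleP[j ->] ->; exists (n * i./2 + j)%N.
have -> : a ^+ i = a ^+ odd i * b ^+ (n * i./2).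
  by rewrite -{1}(odd_double_half i) -mul2n expgD expgM a2 -expgM.
rewrite -mulgA -expgD.
by case: (odd i); [right | left; rewrite mul1g].
Qed.

(** A power of [b] lying in [<[a]>] commutes with [a] but is also inverted by it, so its square is
    trivial and [2 * n] divides [2 * l]. *)
Lemma inverted_exp_in_cycle (gT : finGroupType) (a b : gT) n l :
    #[b] = (2 * n)%N -> b ^ a = b^-1 -> b ^+ l \in <[a]> ->
  n %| l.
Proof.
move=> ob ba /cycleP[i bl_ai].
have : (b ^+ l) ^ a = b ^+ l.
  by rewrite bl_ai; apply/conjg_fixP/commgP/commute_sym/commuteX.
rewrite conjXg ba expgVn => bl_inv.
have : b ^+ (2 * l) = 1 by rewrite mul2n -addnn expgD -{1}bl_inv mulVg.
by move/eqP; rewrite -order_dvdn ob dvdn_pmul2l.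
Qed.

Lemma NC_normal (gT : finGroupType) (H G : {group gT}) :
  H <| G -> NC_subgroup H G.
Proof.
move=> nHG; have [sHG nH] := andP nHG; split=> //.
rewrite (setIidPl nH) mulSGid // gen_subG.
exact: class_support_subG.
Qed.

(** The normalizer of [H] in [G] normalizes the normal closure, so the product set is a group,
    namely the join; it then suffices to find the generators of [G] in it. *)
Lemma NC_subgroupP (gT : finGroupType) (H G : {group gT}) :
  H \subset G ->
  NC_subgroup H G <-> G \subset normal_closure H G <*> 'N_G(H).
Proof.
move=> sHG; have sCG : normal_closure H G \subset G.
  by rewrite gen_subG class_support_subG.
have nCN : 'N_G(H) \subset 'N(normal_closure H G).
  by apply: subset_trans (subsetIl _ _) _; rewrite norms_gen ?class_support_norm.
rewrite norm_joinEr //; split=> [[_ ->] // | sG]; split=> //.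
by apply/eqP; rewrite eqEsubset sG mul_subG ?subsetIl.
Qed.

Lemma exp_even_odd_in (gT : finGroupType) (K : {group gT}) (b : gT) m :
  odd m -> b ^+ 2 \in K -> b ^+ m \in K -> b \in K.
Proof.
move=> odd_m b2K; rewrite -{1}(odd_double_half m) odd_m -mul2n expgD expgM.
by rewrite groupMr ?expg1 // groupX.
Qed.

Lemma dicyclic_PNC (gT : finGroupType) (G : {group gT}) (a b : gT) n :
    G :=: <<[set a; b]>> -> a ^+ 2 = b ^+ n -> b ^ a = b^-1 -> ~~ (4 %| n) ->
  PNC_group G.
Proof.
move=> genG a2 ba n4 H sHG.
have aG : a \in G by rewrite genG mem_gen ?set21.
have bG : b \in G by rewrite genG mem_gen ?set22.
have HP h : h \in H -> exists j, h = b ^+ j \/ h = a * b ^+ j.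
  by move=> /(subsetP sHG); rewrite genG; apply: dicyclic_mem a2 ba.
have [sHb | /subsetPn[x xH xNb]] := boolP (H \subset <[b]>).
  (* Here [H] is generated by some [b ^+ k], which [a] inverts and [b] centralizes. *)
  apply: NC_normal; rewrite /normal sHG genG gen_subG subUset !sub1set /=.
  have/cyclicP[c Hc] := cyclicS sHb (cycle_cyclic b).
  have /cycleP[k ck] : c \in <[b]> by rewrite (subsetP sHb) // Hc cycle_id.
  rewrite Hc ck -cycle_subG cycle_norm_inverted //=.
  by rewrite (subsetP (cent_sub _)) // cent_cycle cent1C groupX ?cent1id.
have [j [xE | xE]] := HP x xH; first by rewrite xE mem_cycle in xNb.
have bx : b ^ x = b^-1 by rewrite xE conjg_inverting_coset.
have x2 : x ^+ 2 = b ^+ n by rewrite xE sqr_inverting_coset.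
apply/NC_subgroupP => //; set K := _ <*> _.
have sHGK g : g \in class_support H G -> g \in K.
  by move=> gC; rewrite mem_gen // inE mem_gen.
have xK : x \in K by rewrite sHGK // (subsetP (sub_class_support _ _)).
(* Both [x] and [x ^ b], which is [x * b ^+ 2], lie in the normal closure. *)
have b2K : b ^+ 2 \in K.
  rewrite -(groupMl _ xK) -(muln1 2) -conjg_inverting_exp // expg1.
  by rewrite sHGK // memJ_class_support.
have bK : b \in K.
  have [odd_n | even_n] := boolP (odd n).
    by apply: (exp_even_odd_in odd_n); rewrite // -x2 groupX.
  have nE : n = (2 * n./2)%N.
    by rewrite mul2n -[LHS]odd_double_half (negPf even_n).
  have odd_m : odd n./2.
    apply: contraNT n4 => /negPf even_m.
    by rewrite nE (@dvdn_pmul2l 2 2) // dvdn2 even_m.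
  apply: (exp_even_odd_in odd_m b2K).
  rewrite mem_gen // inE; apply/orP; right; rewrite inE groupX //=.
  rewrite inE; apply/subsetP=> _ /imsetP[h hH ->].
  (* Powers of [b] in [H] are fixed by [b ^+ n./2]; any other [h] goes to [h * b ^+ n], which is
     [h * h ^+ 2]. *)
  have [i [hE | hE]] := HP h hH.
    by rewrite (conjg_fixP _) // hE //; apply/commgP/commuteX2.
  have bh : b ^ h = b^-1 by rewrite hE conjg_inverting_coset.
  rewrite conjg_inverting_exp // -nE -a2 -(sqr_inverting_coset i ba) -hE.
  by rewrite groupM ?groupX.
by rewrite genG gen_subG subUset !sub1set bK -(groupMr _ (groupX j bK)) -xE xK.
Qed.

Lemma dicyclic_not_PNC (gT : finGroupType) (G : {group gT}) (a b : gT) n :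
    G :=: <<[set a; b]>> -> a ^+ 2 = b ^+ n ->
    #[b] = (2 * n)%N -> b ^ a = b^-1 -> 4 %| n ->
  ~ PNC_group G.
Proof.
move=> genG a2 ob ba n4 PNC.
have even_of k : n %| k -> 2 %| k by apply: dvdn_trans (dvdn_trans _ n4).
have aG : a \in G by rewrite genG mem_gen ?set21.
have saG : <[a]> \subset G by rewrite cycle_subG.
pose K := <<[set a; b ^+ 2]>>%G.
have aK : a \in K by rewrite mem_gen ?set21.
have b2K k : 2 %| k -> b ^+ k \in K.
  by case/dvdnP=> q ->; rewrite mulnC expgM groupX // mem_gen ?set22.
(* The only generator that moves is [a], under [b], and [a ^ b] is [a * b ^+ 2]. Normality of [K]
   then bounds the normal closure of [<[a]>]. *)
have nKG : G \subset 'N(K).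
  rewrite genG gen_subG subUset !sub1set (subsetP (normG K)) //=.
  rewrite inE -genJ gen_subG conjUg !conjg_set1 subUset !sub1set.
  rewrite -{1}[b]expg1 conjg_inverting_exp // groupM ?b2K //=.
  by rewrite (conjg_fixP _) ?b2K //; apply/commgP/commute_sym/commuteX.
have : b \in K.
  have : G \subset K.
    have /NC_subgroupP := PNC <[a]>%G saG; move=> /(_ saG) sG.
    apply: subset_trans sG _; rewrite join_subG; apply/andP; split.
      by rewrite gen_subG class_support_sub_norm // cycle_subG.
    apply/subsetP=> x /setIP[xG xN].
    have : x \in <<[set a; b]>> by rewrite -genG.
    case/(dicyclic_mem a2 ba)=> j xE.
    have bjN : b ^+ j \in 'N(<[a]>).
      by case: xE xN => -> //; rewrite groupMl // (subsetP (normG _)) ?cycle_id.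
    have bjK : b ^+ j \in K.
      (* As [b ^+ j] normalizes [<[a]>], the quotient of [a ^ (b ^+ j)] by [a] lies there; hence
         [n], and so 4, divides [2 * j], and [j] is even. *)
      have : b ^+ (2 * j) \in <[a]>.
        rewrite -(groupMl _ (cycle_id a)) -conjg_inverting_exp //.
        by rewrite memJ_norm ?cycle_id.
      move/(inverted_exp_in_cycle ob ba)/(dvdn_trans n4).
      by rewrite (@dvdn_pmul2l 2 2) //; apply: b2K.
    by case: xE => ->; rewrite ?groupM.
  by move/subsetP; apply; rewrite genG mem_gen ?set22.
rewrite /= gen_inverted_split //.
(* Writing the inverse of [z] as [b ^+ (2 * k)] keeps exponents natural: [b * z^-1 = y] puts an odd
   power of [b] in [<[a]>], so the even [n] would divide an odd number. *)
case/mulsgP=> y z ya; rewrite -groupV => /cycleP[k zE] bE.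
have : b ^+ (1 + 2 * k) \in <[a]>.
  by rewrite expgD expgM -zE expg1 bE mulgK.
move/(inverted_exp_in_cycle ob ba)/even_of.
by rewrite dvdn2 mul2n oddD odd_double.
Qed.

Theorem proposition4p2 (n : nat) (gT : finGroupType) (G : {group gT})
    (a b : gT) (n_gt0 : (0 < n)%N)
    (genG : G :=: <<[set a; b]>>)
    (a2bn : a ^+ 2 = b ^+ n)
    (oa : #[a] = 4)
    (ob : #[b] = (2 * n)%N)
    (conjb : a^-1 * b * a = b^-1) :
  PNC_group G <-> ~~ (4 %| n)%N.
Proof.
have ba : b ^ a = b^-1 by rewrite conjgE mulgA.
split; last exact: dicyclic_PNC genG a2bn ba.
move=> PNC; apply/negP => n4.
exact: (dicyclic_not_PNC genG a2bn ob ba n4 PNC).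
Qed.
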